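(* Suppose $C\in\mathcal S^n_{++}$ and $(\sigma_t)$ are diagonalizable along the same basis for all $0\le t\le T$: $$C=V\,\mathrm{diag}(\Sigma_0^1,\dots,\Sigma_0^n)\,V^\top,\qquad \sigma_t=V\,\mathrm{diag}(\sigma_t^1,\dots,\sigma_t^n)\,V^\top,$$ where $V$ is a fixed orthogonal matrix and the diagonal entries $\sigma^i_t$ solve $$d\sigma^i_t=\sigma^i_tm^i_t\,dt+\sigma^i_t\nu^i_t\,dW^i_t,\qquad i=1,\dots,n .$$ Then the minimizer of $$\inf_{M\in\mathcal M}\Bigl\{\tfrac12\mathrm{tr}(CM_0)+\tfrac12\mathbb E\Bigl[\int_0^T\mathrm{tr}(\sigma_t^2M_t^{-1})\,dt\Bigr]\Bigr\}$$ is $$\bar M_t=V\,\mathrm{diag}(\bar M^1_t,\dots,\bar M^n_t)\,V^\top,$$ where each $\bar M^i$ minimizes the one-dimensional problem $$\inf_{M^i}\Bigl\{\tfrac12\Sigma^i_0M^i_0+\tfrac12\mathbb E\Bigl[\int_0^T(\sigma^i_t)^2(M^i_t)^{-1}dt\Bigr]\Bigr\}.$$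
   Context: $\mathcal S^n_{++}$ denotes the symmetric positive definite real $n\times n$ matrices; $T>0$ is fixed. $W=(W^1,\dots,W^n)$ is an $\mathbb R^n$-valued Brownian motion with augmented filtration $\mathcal F^W$; $\sigma$ is $\mathcal S^n_{++}$-valued, $\mathcal F^W$-adapted with $\int_0^T\mathbb E\|\sigma_t\|^2dt<\infty$. The processes $m^i,\nu^i$ are exogenously given $\mathcal F^W$-adapted processes, regular enough for the stated equations to make sense. $\mathcal M$ is the set of processes $M_t=\mathbb E[M_T\mid\mathcal F^W_t]$, $0\le t\le T$, with $M_T\in L^1(\Omega;\mathcal S^n_{++})$ $\mathcal F^W_T$-measurable and $M_t\in\mathcal S^n_{++}$ for all $t$. The one-dimensional infimum is over strictly positive real-valued $\mathcal F^W$-martingales $M^i=(M^i_t)_{0\le t\le T}$. The processes $\bar M^i$ are (given) minimizers of these scalar problems. *)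

(* Defs.v *)
From HB Require Import structures.
From mathcomp Require Export all_boot all_order all_algebra.
From mathcomp Require Export all_classical all_reals all_analysis.

Set Implicit Arguments.
Unset Strict Implicit.
Unset Printing Implicit Defensive.
Import Order.TTheory GRing.Theory Num.Theory.
Import numFieldNormedType.Exports.
Local Open Scope classical_set_scope.
Local Open Scope ring_scope.

(* A process on the horizon `[0, T] is a function of time and outcome; its
   values at times outside `[0, T] are irrelevant. *)

Definition measurable_wrt (R : realType) (Omega : Type)
    (G : set (set Omega)) (X : Omega -> R) : Prop :=
  preimage_set_system setT X measurable `<=` G.

(* Joint measurability makes the time integrals below meaningful. *)
Definition adapted_process (R : realType) (d : measure_display)
    (Omega : measurableType d) (F : R -> set (set Omega)) (T : R)
    (X : R -> Omega -> R) : Prop :=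
  measurable_fun ([set: Omega] `*` `[0, T])
    (fun p : (Omega * measurableTypeR R)%type => X p.2 p.1)
  /\ forall t, 0 <= t <= T -> measurable_wrt (F t) (X t).

Definition natural_filtration (R : realType) (Omega : Type) (n : nat)
    (W : 'I_n -> R -> Omega -> R) (t : R) : set (set Omega) :=
  <<s \bigcup_(i in [set: 'I_n]) \bigcup_(s in `[0, t])
        preimage_set_system setT (W i s) measurable >>.

Definition augmented_filtration (R : realType) (d : measure_display)
    (Omega : measurableType d) (P : probability Omega R) (n : nat)
    (W : 'I_n -> R -> Omega -> R) (t : R) : set (set Omega) :=
  <<s natural_filtration W t `|` [set N | measurable N /\ P N = 0%E] >>.

(* The last clause says at once that W_t - W_s is independent of the past up to
   time s and that it has law N(0, (t - s) I_n); the second parameter of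
   normal_prob is the standard deviation. *)
Definition brownian_motion (R : realType) (d : measure_display)
    (Omega : measurableType d) (P : probability Omega R) (T : R) (n : nat)
    (W : 'I_n -> R -> Omega -> R) : Prop :=
  [/\ forall i t, 0 <= t <= T -> measurable_fun setT (W i t),
      \forall w \ae P, forall i, W i 0 w = 0,
      \forall w \ae P, forall i, {within `[0, T], continuous (W i ^~ w)}
    & forall s t, 0 <= s -> s < t -> t <= T ->
      forall (A : set Omega) (B : 'I_n -> set R),
      natural_filtration W s A -> (forall i, measurable (B i)) ->
      P (A `&` \bigcap_(i in [set: 'I_n])
                  ((fun w => W i t w - W i s w) @^-1` B i)) =
      (P A * \prod_(i < n) normal_prob 0 (Num.sqrt (t - s)) (B i))%E].

Definition cvg0_in_probability (R : realType) (d : measure_display)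
    (Omega : measurableType d) (P : probability Omega R)
    (X : nat -> Omega -> \bar R) : Prop :=
  forall eps : R, 0 < eps ->
    (fun k => P [set w | (eps%:E <= `|X k w|)%E]) @ \oo --> 0%E.

(* The process equal to coef j on the interval ]grid j, grid (j + 1)], for
   j < pieces. *)
Record simple_process (R : realType) (Omega : Type) := SimpleProcess {
  pieces : nat;
  grid : nat -> R;
  coef : nat -> Omega -> R
}.

Definition simple_adapted (R : realType) (Omega : Type)
    (F : R -> set (set Omega)) (T : R) (H : simple_process R Omega) : Prop :=
  [/\ 0 <= grid H 0, grid H (pieces H) <= T,
      forall j, (j < pieces H)%N -> grid H j <= grid H j.+1
    & forall j, (j < pieces H)%N -> measurable_wrt (F (grid H j)) (coef H j)
        /\ exists c : R, forall w, `|coef H j w| <= c].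

Definition simple_value (R : realType) (Omega : Type)
    (H : simple_process R Omega) (t : R) (w : Omega) : R :=
  \sum_(j < pieces H) coef H j w * \1_`]grid H j, grid H j.+1] t.

Definition simple_integral (R : realType) (Omega : Type)
    (H : simple_process R Omega) (B : R -> Omega -> R) (t : R) (w : Omega) : R :=
  \sum_(j < pieces H) coef H j w *
    (B (Num.min t (grid H j.+1)) w - B (Num.min t (grid H j)) w).

(* I_t = \int_0^t H_u dB_u for 0 <= t <= T: square-integrability of the
   integrand along almost every path, and approximation by simple processes. At
   each time the limit is determined up to a null set; continuity of the paths
   is left to the context in which I is used. *)
Definition is_ito_integral (R : realType) (d : measure_display)
    (Omega : measurableType d) (P : probability Omega R)
    (F : R -> set (set Omega)) (T : R) (H B I : R -> Omega -> R) : Prop :=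
  (\forall w \ae P,
    (\int[lebesgue_measure]_(u in `[0%R, T]) ((H u w) ^+ 2)%:E < +oo)%E)
  /\ adapted_process F T I
  /\ exists S : nat -> simple_process R Omega,
    [/\ forall k, simple_adapted F T (S k),
        cvg0_in_probability P (fun k w =>
          (\int[lebesgue_measure]_(u in `[0%R, T])
             ((simple_value (S k) u w - H u w) ^+ 2)%:E)%E)
      & forall t, 0 <= t <= T -> cvg0_in_probability P (fun k w =>
          (simple_integral (S k) B t w - I t w)%:E)].

(* s is a continuous adapted solution on `[0, T] of
   ds_t = s_t m_t dt + s_t nu_t dB_t. *)
Definition solves_sde (R : realType) (d : measure_display)
    (Omega : measurableType d) (P : probability Omega R)
    (F : R -> set (set Omega)) (T : R) (m nu B s : R -> Omega -> R) : Prop :=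
  [/\ adapted_process F T s,
      \forall w \ae P, {within `[0, T], continuous (s ^~ w)},
      \forall w \ae P, lebesgue_measure.-integrable `[0, T]
        (fun u => (s u w * m u w)%:E)
    & exists I : R -> Omega -> R,
      is_ito_integral P F T (fun u w => s u w * nu u w) B I
      /\ \forall w \ae P, forall t, 0 <= t <= T ->
        s t w = s 0 w
          + \int[lebesgue_measure]_(u in `[0, t]) (s u w * m u w) + I t w].

(* X is a version of E[Y | G]. *)
Definition is_cond_expectation (R : realType) (d : measure_display)
    (Omega : measurableType d) (P : probability Omega R)
    (G : set (set Omega)) (Y X : Omega -> R) : Prop :=
  [/\ measurable_wrt G X, P.-integrable setT (EFin \o X)
    & forall A, G A ->
      (\int[P]_(w in A) (X w)%:E = \int[P]_(w in A) (Y w)%:E)%E].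

Definition martingale (R : realType) (d : measure_display)
    (Omega : measurableType d) (P : probability Omega R)
    (F : R -> set (set Omega)) (T : R) (M : R -> Omega -> R) : Prop :=
  [/\ adapted_process F T M,
      forall t, 0 <= t <= T -> P.-integrable setT (EFin \o M t)
    & forall s t, 0 <= s -> s <= t -> t <= T ->
      is_cond_expectation P (F s) (M t) (M s)].

Definition positive_martingales (R : realType) (d : measure_display)
    (Omega : measurableType d) (P : probability Omega R)
    (F : R -> set (set Omega)) (T : R) : set (R -> Omega -> R) :=
  [set M | martingale P F T M /\ forall t w, 0 <= t <= T -> 0 < M t w].

Definition posdefmx (R : realType) (n : nat) (A : 'M[R]_n) : Prop :=
  A^T = A /\ forall u : 'rV[R]_n, u != 0 -> 0 < (u *m A *m u^T) 0 0.

Definition diag_in_basis (R : realType) (n : nat) (V : 'M[R]_n)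
    (x : 'I_n -> R) : 'M[R]_n :=
  V *m diag_mx (\row_i x i) *m V^T.

(* The class of processes M_t = E[M_T | F_t], entry by entry. *)
Definition posdef_closed_martingales (R : realType) (d : measure_display)
    (Omega : measurableType d) (P : probability Omega R)
    (F : R -> set (set Omega)) (T : R) (n : nat) :
    set (R -> Omega -> 'M[R]_n) :=
  [set M : R -> Omega -> 'M[R]_n |
    [/\ forall i j, adapted_process F T (fun t w => M t w i j),
        forall i j, P.-integrable setT (fun w => (M T w i j)%:E),
        forall t w, 0 <= t <= T -> posdefmx (M t w)
      & forall t, 0 <= t <= T -> forall i j,
          is_cond_expectation P (F t) (fun w => M T w i j)
            (fun w => M t w i j)]].

(* M_0 is almost surely constant, F_0 being trivial; the expectation turns it
   into a number. *)
Definition matrix_cost (R : realType) (d : measure_display)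
    (Omega : measurableType d) (P : probability Omega R) (T : R) (n : nat)
    (C : 'M[R]_n) (sigma M : R -> Omega -> 'M[R]_n) : \bar R :=
  ((2^-1)%:E * 'E_P[fun w => (\tr (C *m M 0%R w))%R] +
   (2^-1)%:E * \int[P]_w \int[lebesgue_measure]_(t in `[0%R, T])
     (\tr (sigma t w *m sigma t w *m invmx (M t w)))%:E)%E.

Definition scalar_cost (R : realType) (d : measure_display)
    (Omega : measurableType d) (P : probability Omega R) (T : R)
    (c : R) (s M : R -> Omega -> R) : \bar R :=
  ((2^-1)%:E * 'E_P[fun w => (c * M 0%R w)%R] +
   (2^-1)%:E * \int[P]_w \int[lebesgue_measure]_(t in `[0%R, T])
     ((s t w) ^+ 2 * (M t w)^-1)%:E)%E.

Definition is_minimizer (R : realType) (X : Type) (D : set X)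
    (J : X -> \bar R) (x : X) : Prop :=
  D x /\ forall y, D y -> (J x <= J y)%E.

(* Main.v *)
(* Write N^i = (V^T M V)_ii for the diagonal of M in the basis V. Each N^i is a
   positive martingale when M is admissible, tr(C M_0) depends only on the N^i,
   and tr(sigma^2 M^-1) = sum_i (sigma^i)^2 (V^T M^-1 V)_ii dominates
   sum_i (sigma^i)^2 / N^i, because (N^-1)_ii >= 1 / N_ii for a positive definite
   matrix N. So the cost of M is at least the sum of the scalar costs of the N^i,
   with equality when M is diagonal in the basis V.
   For uniqueness, average the cost of a minimizer M and that of Mbar and compare
   with the diagonal process with entries (N^i + Mbar^i) / 2: strict convexity of
   the inverse and the equality case above give M_t = Mbar_t almost surely for
   almost every t, the minimal value being finite since the identity has finite
   cost. The martingale property extends the equality to t < T, and to t = T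
   because the augmented filtration of a continuous process is left-continuous
   at T. *)
Require Import Defs.
From mathcomp Require Import all_boot all_order all_algebra.
From mathcomp Require Import all_classical all_reals all_analysis.
From mathcomp Require Import measurable_realfun ring lra.

Set Implicit Arguments.
Unset Strict Implicit.
Unset Printing Implicit Defensive.
Import Order.TTheory GRing.Theory Num.Theory.
Import numFieldNormedType.Exports.
Local Open Scope classical_set_scope.
Local Open Scope ring_scope.

(** * Positive definite matrices in an orthonormal basis *)

Section linear_algebra.
Context (R : realType).
Implicit Types (n : nat).

Lemma mul_rV_quadE n (u : 'rV[R]_n) (x : 'I_n -> R) :
  (u *m diag_mx (\row_i x i) *m u^T) 0 0 = \sum_i x i * u 0 i ^+ 2.
Proof.
rewrite mul_mx_diag mxE; apply: eq_bigr => i _; rewrite !mxE.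
by rewrite mulrAC -expr2 mulrC.
Qed.

Lemma posdefmx_unit n (A : 'M[R]_n) : posdefmx A -> A \in unitmx.
Proof.
move=> [_ A0]; rewrite -row_free_unit; apply: inj_row_free => v vA.
apply/eqP/negPn/negP => /A0; by rewrite vA mul0mx mxE ltxx.
Qed.

Lemma posdefmx_inv_sym n (A : 'M[R]_n) : posdefmx A -> (invmx A)^T = invmx A.
Proof. by move=> [At _]; rewrite trmx_inv At. Qed.

Section orthogonal_basis.
Context (n : nat) (V : 'M[R]_n).
Hypothesis VVt : V *m V^T = 1%:M.

Let VtV : V^T *m V = 1%:M.
Proof. exact: mulmx1C. Qed.

Lemma trmx_diag_in_basis x : (diag_in_basis V x)^T = diag_in_basis V x.
Proof. by rewrite /diag_in_basis !trmx_mul trmxK tr_diag_mx mulmxA. Qed.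

Lemma diag_in_basis_coord x :
  V^T *m diag_in_basis V x *m V = diag_mx (\row_i x i).
Proof.
by rewrite /diag_in_basis !mulmxA VtV mul1mx -mulmxA VtV mulmx1.
Qed.

Lemma diag_in_basis_entry x i j :
  diag_in_basis V x i j = \sum_k V i k * V j k * x k.
Proof.
rewrite /diag_in_basis mul_mx_diag mxE; apply: eq_bigr => k _.
by rewrite !mxE mulrAC.
Qed.

Lemma basis_coord_entry (A : 'M[R]_n) i :
  (V^T *m A *m V) i i = \sum_j \sum_k V k i * V j i * A k j.
Proof.
rewrite mxE; apply: eq_bigr => j _; rewrite !mxE mulr_suml.
by apply: eq_bigr => k _; rewrite !mxE mulrAC.
Qed.

Lemma mul_diag_in_basis x y :
  diag_in_basis V x *m diag_in_basis V y = diag_in_basis V (fun i => x i * y i).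
Proof.
rewrite /diag_in_basis !mulmxA; congr (_ *m _).
rewrite -(mulmxA _ V^T V) VtV mulmx1 -mulmxA mulmx_diag.
by congr (_ *m diag_mx _); apply/rowP => i; rewrite !mxE.
Qed.

Lemma diag_in_basis1 : diag_in_basis V (fun=> 1) = 1%:M.
Proof.
rewrite /diag_in_basis (_ : (\row_i 1) = const_mx 1).
  by rewrite diag_const_mx mulmx1.
by apply/rowP => i; rewrite !mxE.
Qed.

Lemma invmx_diag_in_basis x : (forall i, x i != 0) ->
  invmx (diag_in_basis V x) = diag_in_basis V (fun i => (x i)^-1).
Proof.
move=> x0.
have xV : diag_in_basis V x *m diag_in_basis V (fun i => (x i)^-1) = 1%:M.
  rewrite mul_diag_in_basis -diag_in_basis1; congr (diag_in_basis V _).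
  by apply/funext => i; rewrite divff.
have [xu _] := mulmx1_unit xV.
by rewrite -[invmx _]mulmx1 -xV mulKmx.
Qed.

(** By cyclicity of the trace, a diagonal factor only meets the diagonal of [A] in the basis [V];
    this is how both traces in the cost decouple. *)
Lemma mxtrace_diag_in_basis x (A : 'M[R]_n) :
  \tr (diag_in_basis V x *m A) = \sum_i x i * (V^T *m A *m V) i i.
Proof.
rewrite /diag_in_basis -!mulmxA mxtrace_mulC -!mulmxA (mulmxA V^T).
by apply: eq_bigr => i _; rewrite mul_diag_mx !mxE.
Qed.

(** In the coordinates [u *m V] the quadratic form is a sum of squares weighted by the [x i]. *)
Lemma posdefmx_diag_in_basis x :
  posdefmx (diag_in_basis V x) <-> forall i, 0 < x i.
Proof.
split=> [[_ xpos] i|x0].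
  (* The [i]-th column of [V], written as a row, isolates the weight [x i]. *)
  pose u : 'rV[R]_n := row i V^T.
  have uV : u *m V = delta_mx 0 i.
    by rewrite /u rowE -mulmxA VtV mulmx1.
  have u0 : u != 0.
    apply/negP => /eqP uE; move: uV; rewrite uE mul0mx => /matrixP/(_ 0 i).
    by rewrite !mxE !eqxx => /eqP; rewrite eq_sym oner_eq0.
  have := xpos _ u0.
  rewrite /diag_in_basis !mulmxA -mulmxA -trmx_mul mul_rV_quadE uV.
  rewrite (bigD1 i)//= big1 ?addr0 => [|j ji]; rewrite !mxE ?eqxx.
    by rewrite expr1n mulr1.
  by rewrite (negbTE ji) andbF expr0n mulr0.
split; first exact: trmx_diag_in_basis.
move=> u u0.
have uV0 : u *m V != 0.
  by apply: contra u0 => /eqP uV; rewrite -[u]mulmx1 -VVt mulmxA uV mul0mx.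
rewrite /diag_in_basis !mulmxA -mulmxA -trmx_mul mul_rV_quadE.
have ge0 i : 0 <= x i * (u *m V) 0 i ^+ 2 by rewrite mulr_ge0 ?sqr_ge0 ?ltW.
rewrite lt_neqAle sumr_ge0 ?andbT// eq_sym; apply: contra uV0.
rewrite psumr_eq0// => /allP uV; apply/eqP/rowP => i; rewrite [RHS]mxE.
have := uV i (mem_index_enum _).
by rewrite mulf_eq0 gt_eqF//= sqrf_eq0 => /eqP.
Qed.

(** The entry is the quadratic form of [M] at the [i]-th column of [V], which is nonzero by
    orthogonality. *)
Lemma basis_coord_gt0 (M : 'M[R]_n) i :
  posdefmx M -> 0 < (V^T *m M *m V) i i.
Proof.
move=> [_ M0].
have -> : (V^T *m M *m V) i i = (row i V^T *m M *m (row i V^T)^T) 0 0.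
  by rewrite -!row_mul tr_row trmxK !mxE; apply: eq_bigr => j _; rewrite !mxE.
apply: M0; apply/negP => /eqP ri.
have : row i (V^T *m V) = 0 by rewrite row_mul ri mul0mx.
by rewrite VtV => /rowP/(_ i); rewrite !mxE eqxx => /eqP; rewrite oner_eq0.
Qed.

(** For positive definite [M] it vanishes exactly when the [i]-th column of [V] is an eigenvector of
    [M], the eigenvalue then being (V^T M V)_ii. *)
Let residual (M : 'M[R]_n) i : 'rV[R]_n :=
  row i V^T *m invmx M - ((V^T *m M *m V) i i)^-1 *: row i V^T.

(* The gap between the two sides of Jensen's inequality is the quadratic form
   of M at the residual, hence vanishes only when the residual does. *)
Let residual_quad (M : 'M[R]_n) i : posdefmx M ->
  (residual M i *m M *m (residual M i)^T) 0 0 =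
  (V^T *m invmx M *m V) i i - ((V^T *m M *m V) i i)^-1.
Proof.
move=> Mpos; have Mu := posdefmx_unit Mpos; have MVt := posdefmx_inv_sym Mpos.
set a := (V^T *m M *m V) i i; have a0 : 0 < a by exact: basis_coord_gt0.
set q := (V^T *m invmx M *m V) i i.
have E (A : 'M[R]_n) : (row i V^T *m A *m (row i V^T)^T) 0 0 = (V^T *m A *m V) i i.
  by rewrite -!row_mul tr_row trmxK !mxE; apply: eq_bigr => j _; rewrite !mxE.
have rr : (row i V^T *m (row i V^T)^T) 0 0 = 1.
  by have := E 1%:M; rewrite !mulmx1 => ->; rewrite VtV mxE eqxx.
rewrite /residual -/a mulmxBl mulmxKV// linearB /= trmx_mul MVt linearZ /=.
rewrite mulmxBr !mulmxBl -!scalemxAl -!scalemxAr !mulmxA mulmxK//.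
move: rr (E M) (E (invmx M)); rewrite -/a -/q.
set x := row i V^T *m (row i V^T)^T; set y := row i V^T *m M *m (row i V^T)^T.
set z := _ *m invmx M *m _ => rr Ea Ei.
clearbody x y z q; rewrite !mxE rr Ea Ei.
by field; rewrite gt_eqF.
Qed.

Lemma inv_basis_coord_le (M : 'M[R]_n) i : posdefmx M ->
  ((V^T *m M *m V) i i)^-1 <= (V^T *m invmx M *m V) i i.
Proof.
move=> Mpos; rewrite -subr_ge0 -residual_quad//.
have [->|/Mpos.2/ltW//] := eqVneq (residual M i) 0.
by rewrite !mul0mx mxE.
Qed.

(** Equality for every [i] kills all residuals, so every column of [V] is an eigenvector of [M]. *)
Lemma inv_basis_coord_eq (M : 'M[R]_n) : posdefmx M ->
  (forall i, ((V^T *m M *m V) i i)^-1 = (V^T *m invmx M *m V) i i) ->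
  M = diag_in_basis V (fun i => (V^T *m M *m V) i i).
Proof.
move=> Mpos eqM; have Mu := posdefmx_unit Mpos.
rewrite -[LHS]mul1mx -VVt -[RHS]mulmxA -mulmxA; congr (_ *m _).
apply/row_matrixP => i; rewrite !row_mul row_diag_mx -scalemxAl -rowE mxE.
have res0 : residual M i = 0.
  apply/eqP/negPn/negP => /(Mpos.2).
  by rewrite residual_quad// eqM subrr ltxx.
have /eqP := res0; rewrite subr_eq0 => /eqP /(congr1 (mulmx^~ M)).
rewrite -mulmxA mulVmx// mulmx1 -scalemxAl => rE.
have a0 : (V^T *m M *m V) i i != 0 by rewrite gt_eqF// basis_coord_gt0.
by rewrite {2}rE scalerA divff// scale1r.
Qed.

(** Strict convexity of the inverse: the gap is exactly (a - b)^2 / (2ab(a + b)). *)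
Lemma inv_midpoint_le (a b : R) : 0 < a -> 0 < b ->
  (2^-1 * (a + b))^-1 <= 2^-1 * (a^-1 + b^-1) ?= iff (a == b).
Proof.
move=> a0 b0.
have E : 2^-1 * (a^-1 + b^-1) - (2^-1 * (a + b))^-1
    = (a - b) ^+ 2 * (2 * a * b * (a + b))^-1.
  by field; rewrite !gt_eqF ?addr_gt0//.
have c0 : 0 < (2 * a * b * (a + b))^-1.
  by rewrite invr_gt0 !mulr_gt0 ?addr_gt0.
split; first by rewrite -subr_ge0 E mulr_ge0 ?sqr_ge0 ?ltW.
by rewrite eq_sym -subr_eq0 E mulf_eq0 (gt_eqF c0) orbF sqrf_eq0 subr_eq0.
Qed.

(* The integrand of the cost at M and at diag_in_basis V b, averaged, against
   its value at the midpoint of the diagonals. *)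
Lemma inv_cost_midpoint (t b : 'I_n -> R) (M : 'M[R]_n) :
  posdefmx M -> (forall i, 0 < t i) -> (forall i, 0 < b i) ->
  let c i := 2^-1 * ((V^T *m M *m V) i i + b i) in
  \sum_i t i * (c i)^-1 <=
    2^-1 * (\sum_i t i * (V^T *m invmx M *m V) i i + \sum_i t i * (b i)^-1)
    ?= iff (M == diag_in_basis V b).
Proof.
move=> Mpos t0 b0 c; set a := fun i => (V^T *m M *m V) i i.
have a0 i : 0 < a i by exact: basis_coord_gt0.
rewrite -big_split mulr_sumr /=.
(* Two inequalities are chained term by term: convexity of the inverse in [le1], then in [le2] the
   bound of 1 / (V^T M V)_ii by the diagonal of the inverse. *)
have le1 i : t i * (c i)^-1 <= 2^-1 * (t i * (a i)^-1 + t i * (b i)^-1)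
   ?= iff (a i == b i).
  rewrite -mulrDr mulrCA; apply/leifP.
  have := inv_midpoint_le (a0 i) (b0 i) => /leifP.
  case: ifP => [_ /eqP ->//|_]; by rewrite ltr_pM2l.
have le2 i : 2^-1 * (t i * (a i)^-1 + t i * (b i)^-1) <=
    2^-1 * (t i * (V^T *m invmx M *m V) i i + t i * (b i)^-1).
  by rewrite ler_pM2l ?invr_gt0// lerD2r ler_pM2l// inv_basis_coord_le.
have le3 i : t i * (c i)^-1 <=
    2^-1 * (t i * (V^T *m invmx M *m V) i i + t i * (b i)^-1).
  by rewrite (le_trans (le1 i)).
split; first exact: ler_sum.
apply/eqP/eqP => [eqs|ME].
  (* The terms are ordered by [le3], so equal sums force equal terms. *)
  have eqi i : t i * (c i)^-1 =
      2^-1 * (t i * (V^T *m invmx M *m V) i i + t i * (b i)^-1).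
    have := @psumr_eq0P R _ xpredT (fun i =>
      2^-1 * (t i * (V^T *m invmx M *m V) i i + t i * (b i)^-1)
        - t i * (c i)^-1).
    move=> /(_ (fun i _ => ltac:(by rewrite subr_ge0))).
    rewrite sumrB eqs subrr => /(_ erefl i erefl)/eqP.
    by rewrite subr_eq0 => /eqP.
  (* Equality at the two ends of the chain forces it in [le1], hence [a i = b i]; what remains is
     equality in [le2], which makes [M] diagonal. *)
  have ab i : a i = b i.
    by apply/eqP; rewrite -(le1 i) eq_le (le1 i).1 /= eqi le2.
  apply: etrans (inv_basis_coord_eq Mpos _) _; last first.
    by congr (diag_in_basis V _); apply/funext => i; exact: ab.
  move=> i; have := eqi i; rewrite /c -/(a i) ab.
  rewrite -mulrDr mulrCA => /(mulfI (lt0r_neq0 (t0 i))).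
  by rewrite (_ : 2^-1 * (b i + b i) = b i) => [h|]; lra.
apply: eq_bigr => i _; rewrite /c ME invmx_diag_in_basis//; last first.
  by move=> j; rewrite gt_eqF.
rewrite !diag_in_basis_coord !mxE eqxx !mulr1n.
by field; rewrite !gt_eqF// addr_gt0.
Qed.

End orthogonal_basis.
End linear_algebra.

(** * Integrals over time and probability space *)

Section measurability.
Context d (U : measurableType d) (R : realType) (D : set U).

(* x^-1 = x (x^2)^-1, also at x = 0, and the inverse of a nonnegative number is
   a power. *)
Lemma measurable_fun_inv (f : U -> R) :
  measurable_fun D f -> measurable_fun D (fun x => (f x)^-1).
Proof.
move=> mf.
rewrite (_ : (fun x => _) = fun x => f x * (powR (f x ^+ 2) (-1))).
  apply: measurable_funM => //.
  apply: (@measurableT_comp _ _ _ _ _ _ (fun y : R => powR y (-1))).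
    exact: measurable_powR.
  exact: measurable_funX.
apply/funext => x; rewrite powR_inv1 ?sqr_ge0//.
have [->|fx0] := eqVneq (f x) 0; first by rewrite invr0 mul0r.
by field.
Qed.

Lemma measurable_det n (A : U -> 'M[R]_n) :
  (forall i j, measurable_fun D (fun x => A x i j)) ->
  measurable_fun D (fun x => \det (A x)).
Proof.
move=> mA; apply: measurable_sum => s; apply: measurable_funM => //.
by apply: measurable_prod => i _.
Qed.

(** Cramer's formula: on invertible matrices the entries of the inverse are cofactors divided by the
    determinant. *)
Lemma measurable_invmx n (A : U -> 'M[R]_n) :
  (forall x, D x -> A x \in unitmx) ->
  (forall i j, measurable_fun D (fun x => A x i j)) ->
  forall i j, measurable_fun D (fun x => invmx (A x) i j).
Proof.
move=> Au mA i j.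
apply: (@eq_measurable_fun _ _ _ _ _
  (fun x => (\det (A x))^-1 * cofactor (A x) j i)).
  by move=> x /set_mem Dx; rewrite /invmx Au// !mxE.
apply: measurable_funM; first exact/measurable_fun_inv/measurable_det.
apply: measurable_funM => //; apply: measurable_det => k l.
rewrite (_ : (fun x => _) = fun x => A x (lift j k) (lift i l))//.
by apply/funext => x; rewrite !mxE.
Qed.

End measurability.

(** * Tonelli's theorem for nonnegative processes *)

Section space_time_integral.
Context (R : realType) d (Omega : measurableType d) (P : probability Omega R).
Context (T : R).

Let strip : set (Omega * measurableTypeR R) := [set: Omega] `*` `[0, T].
Let leb : {sigma_finite_measure set (measurableTypeR R) -> \bar R} :=
  lebesgue_measure.

Definition jointly_measurable (X : R -> Omega -> R) :=
  measurable_fun ([set: Omega] `*` `[0, T])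
    (fun p : (Omega * measurableTypeR R)%type => X p.2 p.1).

Definition nonneg_process (X : R -> Omega -> R) :=
  forall t w, 0 <= t <= T -> 0 <= X t w.

(** The order of integration is that of [matrix_cost] and [scalar_cost]. *)
Definition space_time_integral (X : R -> Omega -> R) : \bar R :=
  (\int[P]_w \int[lebesgue_measure]_(t in `[0%R, T]) (X t w)%:E)%E.

Let mstrip : measurable strip.
Proof. by apply: measurableX => //; exact: measurable_itv. Qed.

(** Extension by zero off the strip, so that Tonelli's theorem applies on the whole product. *)
Let ext (X : R -> Omega -> R) : Omega * measurableTypeR R -> \bar R :=
  (fun p => (X p.2 p.1)%:E) \_ strip.

Let extE X w t : ext X (w, t) = if 0 <= t <= T then (X t w)%:E else 0%E.
Proof.
rewrite /ext patchE /=; case: ifPn.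
  by rewrite inE => -[_ /=]; rewrite in_itv/= => ->.
rewrite notin_setE => st; case: ifPn => // tT; exfalso; apply: st.
by split => //=; rewrite in_itv.
Qed.

Let measurable_ext X : jointly_measurable X -> measurable_fun setT (ext X).
Proof.
by move=> mX; apply/(measurable_restrictT _ _).1 => //; exact/measurable_EFinP.
Qed.

Let ext_ge0 X : nonneg_process X -> forall p, (0 <= ext X p)%E.
Proof. by move=> X0 [w t]; rewrite extE; case: ifPn => // /X0; rewrite lee_fin. Qed.

Let ext_sectionE X w :
  (\int[leb]_t ext X (w, t) = \int[lebesgue_measure]_(t in `[0%R, T]) (X t w)%:E)%E.
Proof.
rewrite [RHS]integral_mkcond; apply: eq_integral => t _.
by rewrite extE patchE mem_setE in_itv.
Qed.

Lemma space_time_integralE X : jointly_measurable X -> nonneg_process X ->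
  (space_time_integral X = \int[P \x leb]_(p in strip) (X p.2 p.1)%:E)%E.
Proof.
move=> mX X0; rewrite integral_mkcond.
rewrite (fubini_tonelli1 (ext X)); [|exact: measurable_ext|exact: ext_ge0].
by apply: eq_integral => w _; rewrite /fubini_F ext_sectionE.
Qed.

Let ext_cosectionE X t : (\int[P]_w ext X (w, t) =
  ((fun t => \int[P]_w (X t w)%:E) \_ `[0%R, T]) t)%E.
Proof.
rewrite patchE mem_setE in_itv /=; case: ifPn => tT; last first.
  by apply: integral0_eq => w _; rewrite extE (negbTE tT).
by apply: eq_integral => w _; rewrite extE tT.
Qed.

(** Time outermost is the order of the square-integrability assumption on [sigma], and the one that
    yields statements at almost every fixed time. *)
Lemma space_time_integral_swap X : jointly_measurable X -> nonneg_process X ->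
  (space_time_integral X =
   \int[lebesgue_measure]_(t in `[0%R, T]) \int[P]_w (X t w)%:E)%E.
Proof.
move=> mX X0; rewrite space_time_integralE// integral_mkcond.
rewrite (fubini_tonelli2 (ext X)); [|exact: measurable_ext|exact: ext_ge0].
rewrite [RHS]integral_mkcond.
by apply: eq_integral => t _; rewrite /fubini_G ext_cosectionE.
Qed.

Lemma jointly_measurable_section X t : jointly_measurable X -> 0 <= t <= T ->
  measurable_fun setT (X t).
Proof.
move=> mX tT; apply/measurable_EFinP.
rewrite (_ : _ \o _ = ext X \o pair^~ t).
  by apply: measurableT_comp; [exact: measurable_ext|exact: pair2_measurable].
by apply/funext => w /=; rewrite extE tT.
Qed.

Lemma space_time_integral_ge0 X :
  nonneg_process X -> (0 <= space_time_integral X)%E.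
Proof.
move=> X0; apply: integral_ge0 => w _; apply: integral_ge0 => t /=.
by rewrite in_itv/= lee_fin => /X0.
Qed.

Lemma eq_space_time_integral X Y : (forall t w, 0 <= t <= T -> X t w = Y t w) ->
  space_time_integral X = space_time_integral Y.
Proof.
move=> XY; apply: eq_integral => w _; apply: eq_integral => t.
by rewrite inE/= in_itv/= => /XY ->.
Qed.

Lemma jointly_measurableD X Y : jointly_measurable X -> jointly_measurable Y ->
  jointly_measurable (fun t w => X t w + Y t w).
Proof. exact: measurable_funD. Qed.

Lemma jointly_measurableM X Y : jointly_measurable X -> jointly_measurable Y ->
  jointly_measurable (fun t w => X t w * Y t w).
Proof. exact: measurable_funM. Qed.

Lemma jointly_measurableZ c X : jointly_measurable X ->
  jointly_measurable (fun t w => c * X t w).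
Proof. by move=> mX; apply: measurable_funM. Qed.

Lemma jointly_measurable_sum (I : Type) (r : seq I) (X : I -> R -> Omega -> R) :
  (forall i, jointly_measurable (X i)) ->
  jointly_measurable (fun t w => \sum_(i <- r) X i t w).
Proof. by move=> mX; apply: measurable_sum. Qed.

Lemma space_time_integralD X Y :
  jointly_measurable X -> nonneg_process X ->
  jointly_measurable Y -> nonneg_process Y ->
  space_time_integral (fun t w => X t w + Y t w) =
  (space_time_integral X + space_time_integral Y)%E.
Proof.
move=> mX X0 mY Y0; rewrite !space_time_integralE//; last 2 first.
- exact: jointly_measurableD.
- by move=> t w tT; rewrite addr_ge0 ?X0 ?Y0.
rewrite -ge0_integralD//=.
- by move=> [w t] [_ /=]; rewrite in_itv/= lee_fin => /X0.
- exact/measurable_EFinP.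
- by move=> [w t] [_ /=]; rewrite in_itv/= lee_fin => /Y0.
- exact/measurable_EFinP.
Qed.

Lemma space_time_integralZ c X : 0 <= c ->
  jointly_measurable X -> nonneg_process X ->
  space_time_integral (fun t w => c * X t w) = (c%:E * space_time_integral X)%E.
Proof.
move=> c0 mX X0; rewrite !space_time_integralE//; last 2 first.
- exact: jointly_measurableZ.
- by move=> t w tT; rewrite mulr_ge0 ?X0.
rewrite -ge0_integralZl_EFin//=.
- by move=> [w t] [_ /=]; rewrite in_itv/= lee_fin => /X0.
- exact/measurable_EFinP.
Qed.

Lemma space_time_integral_sum (I : Type) (r : seq I) (X : I -> R -> Omega -> R) :
  (forall i, jointly_measurable (X i)) -> (forall i, nonneg_process (X i)) ->
  space_time_integral (fun t w => \sum_(i <- r) X i t w) =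
  (\sum_(i <- r) space_time_integral (X i))%E.
Proof.
move=> mX X0; elim: r => [|i r ih].
  rewrite big_nil (@eq_space_time_integral _ (fun _ _ => 0)); last first.
    by move=> t w _; rewrite big_nil.
  by apply: integral0_eq => w _; exact: integral0_eq.
rewrite big_cons -ih -space_time_integralD//.
- by apply: eq_space_time_integral => t w _; rewrite big_cons.
- exact: jointly_measurable_sum.
- by move=> t w tT; rewrite sumr_ge0// => j _; exact: X0.
Qed.

Lemma le_space_time_integral X Y : jointly_measurable X -> nonneg_process X ->
  jointly_measurable Y -> (forall t w, 0 <= t <= T -> X t w <= Y t w) ->
  (space_time_integral X <= space_time_integral Y)%E.
Proof.
move=> mX X0 mY XY.
have Y0 : nonneg_process Y by move=> t w tT; exact: le_trans (X0 _ _ tT) (XY _ _ tT).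
rewrite !space_time_integralE//; apply: ge0_le_integral => //.
- by move=> [w t] [_ /=]; rewrite in_itv/= lee_fin => /X0.
- exact/measurable_EFinP.
- exact/measurable_EFinP.
- by move=> [w t] [_ /=]; rewrite in_itv/= lee_fin => /XY.
Qed.

(** After the swap, the vanishing of a nonnegative function with zero integral is used twice: first
    in time, then in the outcome. *)
Lemma space_time_integral_eq0 X : jointly_measurable X -> nonneg_process X ->
  space_time_integral X = 0%E ->
  \forall t \ae lebesgue_measure,
    0 <= t <= T -> \forall w \ae P, X t w = 0.
Proof.
move=> mX X0; rewrite space_time_integral_swap// => I0.
pose g (t : measurableTypeR R) : \bar R := (\int[P]_w (X t w)%:E)%E.
have mI : measurable (`[0, T]%classic : set (measurableTypeR R)).
  exact: measurable_itv.
(* Measurability of the partial integral is part of Tonelli's theorem for [ext X], and is then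
   restricted to the horizon. *)
have mg : measurable_fun (`[0, T]%classic : set (measurableTypeR R)) g.
  have : measurable_fun setT (fubini_G P (ext X)).
    by apply: measurable_fun_fubini_tonelli_G; [exact: measurable_ext|exact: ext_ge0].
  rewrite (_ : fubini_G P (ext X) = g \_ (`[0, T]%classic : set (measurableTypeR R))).
    by move/(measurable_restrictT g mI).2.
  by apply/funext => t; rewrite /fubini_G ext_cosectionE.
have g0 t : 0 <= t <= T -> (0 <= g t)%E.
  by move=> tT; apply: integral_ge0 => w _; rewrite lee_fin X0.
have /(ae_eq_integral_abs leb mI mg).1 : (\int[leb]_(t in `[0%R, T]) `|g t| = 0)%E.
  rewrite -[RHS]I0; apply: eq_integral => t; rewrite inE/= in_itv/= => tT.
  by rewrite gee0_abs ?g0.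
apply: filterS => t gt0 tT.
have {}gt0 : g t = 0%E by apply: gt0; rewrite /= in_itv.
have mXt : measurable_fun setT (EFin \o X t).
  by apply/measurable_EFinP; exact: jointly_measurable_section.
have /(ae_eq_integral_abs P measurableT mXt).1 :
    (\int[P]_w `|(EFin \o X t) w| = 0)%E.
  by rewrite -[RHS]gt0; apply: eq_integral => w _; rewrite gee0_abs ?lee_fin ?X0.
by apply: filterS => w Xw0; apply: EFin_inj; exact: Xw0.
Qed.

End space_time_integral.

(** Otherwise the interval, of measure [b - a > 0], would lie in a null set. *)
Lemma ae_lebesgue_itv_ex (R : realType) (a b : R) (Q : R -> Prop) : a < b ->
  (\forall t \ae lebesgue_measure, Q t) -> exists2 t, a < t < b & Q t.
Proof.
move=> ab [N [mN N0 QN]]; apply: contrapT => /forall2NP nQ.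
have abN : `]a, b[ `<=` N.
  move=> t /=; rewrite in_itv/= => tab; apply: QN => /= Qt.
  by have [] := nQ t.
have := @le_measure _ _ _ (@lebesgue_measure R) `]a, b[%classic N.
rewrite !inE => /(_ (measurable_itv _) mN abN) le_abN.
have : (lebesgue_measure (`]a, b[%classic : set R) <= 0)%E by rewrite -N0.
by rewrite lebesgue_measure_itv/= lte_fin ab -EFinB lee_fin subr_le0 leNgt ab.
Qed.

(** * Filtrations and conditional expectations *)

Section sub_sigma_algebra.
Context (R : realType) d (Omega : measurableType d) (P : probability Omega R).
Implicit Types (G : set (set Omega)) (X Y Z : Omega -> R).

(** The bridge from a sigma-algebra given as a set of sets to a measurable space, through which
    closure properties of measurable sets and functions transfer to [G]. *)
Lemma measurable_g_sigmaE G : sigma_algebra setT G ->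
  (measurable : set (set (g_sigma_algebraType G))) = G.
Proof. exact: sigma_algebra_id. Qed.

Lemma sigma_algebra_setI G (A B : set Omega) :
  sigma_algebra setT G -> G A -> G B -> G (A `&` B).
Proof.
move=> /measurable_g_sigmaE GE.
by have := @measurableI _ (g_sigma_algebraType G) A B; rewrite GE; apply.
Qed.

Lemma sigma_algebra_setU G (A B : set Omega) :
  sigma_algebra setT G -> G A -> G B -> G (A `|` B).
Proof.
move=> /measurable_g_sigmaE GE.
by have := @measurableU _ (g_sigma_algebraType G) A B; rewrite GE; apply.
Qed.

Lemma measurable_wrtP G X : sigma_algebra setT G ->
  measurable_wrt G X <->
  measurable_fun (setT : set (g_sigma_algebraType G)) X.
Proof.
move=> sG; split=> [GX _ B mB|mX _ [B mB <-]].
  rewrite measurable_g_sigmaE//; apply: GX; exact: imageP.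
by have := mX measurableT B mB; rewrite measurable_g_sigmaE.
Qed.

Lemma measurable_wrt_sum G (I : Type) (r : seq I) (c : I -> R)
    (X : I -> Omega -> R) : sigma_algebra setT G ->
  (forall i, measurable_wrt G (X i)) ->
  measurable_wrt G (fun w => \sum_(i <- r) c i * X i w).
Proof.
move=> sG GX; apply/measurable_wrtP => //; apply: measurable_sum => i.
by apply: measurable_funM => //; exact/measurable_wrtP.
Qed.

Lemma integral_lincomb (A : set Omega) (I : Type) (r : seq I) (c : I -> R)
    (X : I -> Omega -> R) : measurable A ->
  (forall i, P.-integrable setT (EFin \o X i)) ->
  (\int[P]_(w in A) (\sum_(i <- r) c i * X i w)%:E =
   \sum_(i <- r) (c i)%:E * \int[P]_(w in A) (X i w)%:E)%E.
Proof.
move=> mA iX.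
have iXA i : P.-integrable A (EFin \o X i).
  by apply: (integrableS measurableT) => //; exact: iX.
under eq_integral do rewrite -sumEFin.
under eq_integral do under eq_bigr do rewrite EFinM.
rewrite integral_sum//=.
  by apply: eq_bigr => i _; rewrite integralZl//; exact: iXA.
by move=> i; apply: integrableZl => //; exact: iXA.
Qed.

Lemma integrable_lincomb (I : Type) (r : seq I) (c : I -> R)
    (X : I -> Omega -> R) :
  (forall i, P.-integrable setT (EFin \o X i)) ->
  P.-integrable setT (EFin \o (fun w => \sum_(i <- r) c i * X i w)).
Proof.
move=> iX; have : P.-integrable setT
    (fun w => (\sum_(i <- r) (c i)%:E * (X i w)%:E)%E).
  by apply: integrable_sum => // i _; apply: integrableZl => //; exact: iX.
congr (_.-integrable _ _); apply/funext => w.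
by rewrite /= -sumEFin; apply: eq_bigr => i _; rewrite EFinM.
Qed.

Lemma is_cond_expectation_sum G (I : Type) (r : seq I) (c : I -> R)
    (X Y : I -> Omega -> R) :
  sigma_algebra setT G -> G `<=` measurable ->
  (forall i, P.-integrable setT (EFin \o Y i)) ->
  (forall i, is_cond_expectation P G (Y i) (X i)) ->
  is_cond_expectation P G (fun w => \sum_(i <- r) c i * Y i w)
                          (fun w => \sum_(i <- r) c i * X i w).
Proof.
move=> sG Gm iY GX; split.
- by apply: measurable_wrt_sum => // i; have [] := GX i.
- by apply: integrable_lincomb => i; have [] := GX i.
move=> A GA; have mA := Gm _ GA.
rewrite !integral_lincomb//; last by move=> i; have [] := GX i.
by apply: eq_bigr => i _; have [_ _ ->] := GX i.
Qed.

Lemma ae_eq0_on Z (E : set Omega) : measurable E ->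
  P.-integrable setT (EFin \o Z) -> (\int[P]_(w in E) (Z w)%:E = 0)%E ->
  (forall w, E w -> 0 <= Z w) -> \forall w \ae P, E w -> Z w = 0.
Proof.
move=> mE iZ ZE Z0.
have mZ : measurable_fun E (EFin \o Z).
  by apply: (measurable_funS measurableT) => //; exact: measurable_int iZ.
have /(ae_eq_integral_abs P mE mZ).1 : (\int[P]_(w in E) `|(EFin \o Z) w| = 0)%E.
  rewrite -[RHS]ZE; apply: eq_integral => w /set_mem/Z0 Zw0.
  by rewrite gee0_abs ?lee_fin.
by apply: filterS => w ZEw Ew; apply: EFin_inj; exact: ZEw.
Qed.

(** Measurability of [Z] puts the events [0 <= Z] and [Z <= 0] in [G]; on each of them [Z] has a
    constant sign and zero integral. *)
Lemma ae_eq0_of_integrals G Z : sigma_algebra setT G -> G `<=` measurable ->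
  measurable_wrt G Z -> P.-integrable setT (EFin \o Z) ->
  (forall A, G A -> \int[P]_(w in A) (Z w)%:E = 0)%E ->
  \forall w \ae P, Z w = 0.
Proof.
move=> sG Gm GZ iZ Z0.
have GE (B : set R) : measurable B -> G (Z @^-1` B).
  by move=> mB; apply: GZ; exists B => //; rewrite setTI.
have ge0 : \forall w \ae P, (Z @^-1` `[0, +oo[) w -> Z w = 0.
  have GE0 := GE _ (measurable_itv `[0, +oo[).
  apply: (ae_eq0_on (Gm _ GE0)) => //; first exact: Z0.
  by move=> w /=; rewrite in_itv/= andbT.
have le0 : \forall w \ae P, (Z @^-1` `]-oo, 0]) w -> - Z w = 0.
  have GE0 := GE _ (measurable_itv `]-oo, 0]).
  apply: (ae_eq0_on (Gm _ GE0)) => //.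
  - exact: integrableN iZ.
  - have iZE : P.-integrable (Z @^-1` `]-oo, 0]) (EFin \o Z).
      by apply: (integrableS measurableT) => //; exact: Gm.
    under eq_integral do rewrite EFinN -mulN1e.
    by rewrite integralZl ?Z0 ?mule0//; exact: Gm.
  - by move=> w /=; rewrite in_itv/= oppr_ge0.
apply: filterS2 ge0 le0 => w /= ge le.
have [Zw0|/ltW Zw0] := leP 0 (Z w); first by apply: ge; rewrite in_itv/= Zw0.
by apply/eqP; rewrite -oppr_eq0 le// in_itv/=.
Qed.

(** The pi-lambda theorem: the measurable sets over which [Z] integrates to zero form a Dynkin
    system, complements being handled by [G setT] and disjoint unions by countable additivity. *)
Lemma integral0_g_sigma_algebra G Z : setI_closed G -> G `<=` measurable ->
  G setT -> P.-integrable setT (EFin \o Z) ->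
  (forall A, G A -> \int[P]_(w in A) (Z w)%:E = 0)%E ->
  forall A, <<s G >> A -> (\int[P]_(w in A) (Z w)%:E = 0)%E.
Proof.
move=> IG Gm GT iZ Z0.
pose H := [set A | measurable A /\ (\int[P]_(w in A) (Z w)%:E = 0)%E].
suff GH : <<s G >> `<=` H by move=> A /GH[].
have iZA A : measurable A -> P.-integrable A (EFin \o Z).
  by move=> mA; exact: (integrableS measurableT).
apply: lambda_system_subset => //.
- apply/dynkin_lambda_system; split.
  + by split => //; exact: Z0.
  + move=> A [mA ZA]; have mCA : measurable (~` A) by exact: measurableC.
    split=> //; have := Z0 _ GT; rewrite -(setUv A) integral_setU//.
    * by rewrite ZA add0e.
    * by rewrite setUv; exact: measurable_int iZ.
    * by rewrite disj_set2E setICr.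
  + move=> F tF HF; have mF k : measurable (F k) by have [] := HF k.
    have mU : measurable (\bigcup_k F k) by exact: bigcup_measurable.
    split=> //; rewrite integral_bigcup//; last exact: iZA.
    by rewrite eseries0// => i _ _; have [] := HF i.
- by move=> A GA; split; [exact: Gm|exact: Z0].
Qed.

End sub_sigma_algebra.

(** * Martingales closed by their value at the horizon *)

Section filtration.
Context (R : realType) d (Omega : measurableType d) (P : probability Omega R).
Context (T : R) (F : R -> set (set Omega)).
Hypothesis T_gt0 : 0 < T.
Hypothesis F_sigma : forall t, sigma_algebra setT (F t).
Hypothesis F_measurable : forall t, t <= T -> F t `<=` measurable.
Hypothesis F_mono : forall s t, s <= t -> F s `<=` F t.
Hypothesis F_left : F T `<=` <<s \bigcup_(t in `[0, T[) F t >>.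

(** The conditions that [posdef_closed_martingales] imposes on each entry. *)
Definition closed_martingale (X : R -> Omega -> R) :=
  [/\ adapted_process F T X, P.-integrable setT (EFin \o X T)
    & forall t, 0 <= t <= T -> is_cond_expectation P (F t) (X T) (X t)].

Let TT : 0 <= T <= T. Proof. by rewrite lexx ltW. Qed.

(** Tower property: a set of [F s] also lies in [F t], so over it [X s] and [X t] both integrate to
    the integral of [X T]. This reconciles the matrix class with the scalar one. *)
Lemma closed_martingaleP X : closed_martingale X <-> martingale P F T X.
Proof.
split=> [[aX iX cX]|[aX iX cX]]; last first.
  by split=> // [|t /andP[t0 tT]]; [exact: iX|exact: cX].
have inX t : 0 <= t <= T -> P.-integrable setT (EFin \o X t).
  by move=> /cX[].
split=> // s t s0 st tT.
have sT : 0 <= s <= T by rewrite s0 (le_trans st).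
have tT' : 0 <= t <= T by rewrite tT (le_trans s0).
have [mXs iXs Xs] := cX _ sT; have [_ _ Xt] := cX _ tT'.
by split=> // A FA; rewrite Xs// Xt//; exact: F_mono FA.
Qed.

(** Passing between the entries of a matrix process and its diagonal in the basis [V] is linear with
    constant coefficients. *)
Lemma closed_martingale_sum (I : Type) (r : seq I) (c : I -> R)
    (X : I -> R -> Omega -> R) : (forall i, closed_martingale (X i)) ->
  closed_martingale (fun t w => \sum_(i <- r) c i * X i t w).
Proof.
move=> mX; split.
- split=> [|t tT].
    apply: measurable_sum => i; apply: measurable_funM => //.
    by have [[]] := mX i.
  by apply: measurable_wrt_sum => // i; have [[_ aX] _ _] := mX i; exact: aX.
- by apply: integrable_lincomb => i; have [] := mX i.
move=> t tT; have [t0 tT'] := andP tT.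
apply: is_cond_expectation_sum => // [|i|i]; first exact: F_measurable.
  by have [] := mX i.
by have [_ _] := mX i; apply.
Qed.

Lemma closed_martingaleB X Y : closed_martingale X -> closed_martingale Y ->
  closed_martingale (fun t w => X t w - Y t w).
Proof.
move=> mX mY.
(* The difference is a combination indexed by the booleans, with coefficients 1 and -1. *)
have := @closed_martingale_sum bool [:: true; false]
  (fun b => if b then 1 else -1) (fun b => if b then X else Y)
  (fun b => if b return closed_martingale (if b then X else Y) then mX else mY).
congr closed_martingale; apply/funext => t; apply/funext => w.
by rewrite !big_cons big_nil addr0 mul1r mulN1r.
Qed.

Lemma closed_martingale_cst c : closed_martingale (fun _ _ => c).
Proof.
have ic : P.-integrable setT (EFin \o (cst c : Omega -> R)).
  exact: finite_measure_integrable_cst.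
have ac t : measurable_wrt (F t) (cst c : Omega -> R).
  by apply/measurable_wrtP; [exact: F_sigma|exact: measurable_cst].
by split=> //; split=> // t _; exact: ac.
Qed.

(* For A in F t0, t0 < T, the integral of X T over A is that of X t for some
   t > t0 with X t = 0, hence zero; as these A generate F T, X T = 0. *)
Lemma closed_martingale_eq0 X : closed_martingale X ->
  (forall t0, 0 <= t0 < T -> exists2 t, t0 < t < T & \forall w \ae P, X t w = 0) ->
  forall t, 0 <= t <= T -> \forall w \ae P, X t w = 0.
Proof.
move=> [[_ aX] iX cX] X0.
have FX0 A : (\bigcup_(t in `[0, T[) F t) A -> (\int[P]_(w in A) (X T w)%:E = 0)%E.
  move=> [t0 /=]; rewrite in_itv/= => t0T FA.
  have [t /andP[t0t tT] Xt0] := X0 _ t0T.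
  have tT' : 0 <= t <= T.
    by rewrite (ltW tT) andbT (le_trans _ (ltW t0t))//; case/andP: t0T.
  have [_ iXt <-] := cX _ tT'; last exact: F_mono (ltW t0t) _ FA.
  have mA : measurable A by apply: F_measurable FA; apply/ltW; case/andP: t0T.
  rewrite (ae_eq_integral (cst 0%E))//.
  - exact: integral0.
  - by apply: (measurable_funS measurableT) => //; exact: measurable_int iXt.
  - by apply: filterS Xt0 => w Xtw _; rewrite /= Xtw.
have FTX0 A : F T A -> (\int[P]_(w in A) (X T w)%:E = 0)%E.
  move=> /F_left; apply: integral0_g_sigma_algebra => //.
  (* The union is stable under intersection because two of its members both lie in the later of
     their two sigma-algebras. *)
  - move=> B C [s /= sT FB] [t /= tT FC].
    have [st|ts] := leP s t.
      by exists t => //; apply: sigma_algebra_setI => //; exact: F_mono FB.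
    exists s => //; apply: sigma_algebra_setI => //.
    exact: F_mono (ltW ts) _ FC.
  - move=> B [t /=]; rewrite in_itv/= => /andP[_ /ltW tT]; exact: F_measurable.
  - exists 0; first by rewrite /= in_itv/= lexx.
    by have [F0 FC _] := F_sigma 0; rewrite -(setD0 setT); exact: FC.
move=> t tT; have [t0 tT'] := andP tT; have [mXt iXt Xt] := cX _ tT.
apply: ae_eq0_of_integrals mXt iXt _ => //; first exact: F_measurable.
by move=> A FA; rewrite Xt// FTX0//; exact: F_mono FA.
Qed.

End filtration.

(** * The augmented Brownian filtration *)

Section augmented_filtration.
Context (R : realType) d (Omega : measurableType d) (P : probability Omega R).
Context (T : R) (n : nat) (W : 'I_n -> R -> Omega -> R).
Hypothesis T_gt0 : 0 < T.
Hypothesis W_brownian : brownian_motion P T W.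

Let F := augmented_filtration P W.

Lemma augmented_sigma_algebra t : sigma_algebra setT (F t).
Proof. exact: smallest_sigma_algebra. Qed.

(** The bound on [t] appears because [brownian_motion] makes [W i s] measurable only for [s] in the
    horizon. *)
Lemma augmented_measurable t : t <= T -> F t `<=` measurable.
Proof.
move=> tT; have [mW _ _ _] := W_brownian.
apply: smallest_sub; first exact: sigma_algebra_measurable.
move=> A [|[]//]; apply: smallest_sub A; first exact: sigma_algebra_measurable.
move=> A [i _ [s /= ]]; rewrite in_itv/= => /andP[s0 st] [B mB <-].
by apply: mW => //; rewrite s0 (le_trans st).
Qed.

Lemma augmented_mono s t : s <= t -> F s `<=` F t.
Proof.
move=> st; apply: sub_sigma_algebra2; apply: setSU; apply: sub_sigma_algebra2.
move=> A [i _ [u /=]]; rewrite in_itv/= => /andP[u0 us] WA.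
by exists i => //; exists u => //=; rewrite in_itv/= u0 (le_trans us).
Qed.

Lemma augmented_null t N : measurable N -> P N = 0%E -> F t N.
Proof. by move=> mN PN; apply: sub_sigma_algebra; right. Qed.

Lemma augmented_path i s t : 0 <= s -> s <= t -> measurable_wrt (F t) (W i s).
Proof.
move=> s0 st A WA; apply: sub_sigma_algebra; left; apply: sub_sigma_algebra.
by exists i => //; exists s => //=; rewrite in_itv/= s0.
Qed.

(* Almost surely W_T is the limit of W_t for t < T, and the exceptional set
   belongs to F 0. *)
Lemma augmented_left_continuous : F T `<=` <<s \bigcup_(t in `[0, T[) F t >>.
Proof.
have [mW _ [N [mN PN WN]] _] := W_brownian.
set G := \bigcup_(t in _) F t.
have sG : sigma_algebra setT <<s G >> by exact: smallest_sigma_algebra.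
have subG t A : 0 <= t -> t < T -> F t A -> <<s G >> A.
  by move=> t0 tT FA; apply: sub_sigma_algebra; exists t => //=; rewrite in_itv/= t0.
have nullG A : measurable A -> P A = 0%E -> <<s G >> A.
  by move=> mA PA; apply: (subG 0) => //; exact: augmented_null.
apply: smallest_sub => // A [|[]]; last exact: nullG.
apply: smallest_sub A => // A [i _ [s /=]]; rewrite in_itv/= => /andP[s0].
(* A generator at a time [s < T] already belongs to [F s]; the real case is [s = T]. *)
rewrite le_eqVlt => /orP[/eqP ->|sT]; last first.
  by move=> WA; apply: (subG s) => //; exact: (augmented_path s0 (lexx s)) WA.
move=> [B mB <-]; rewrite setTI.
(* A sequence in [[0, T[] that starts at 0 and converges to [T]. *)
pose u k : R := T * (1 - k.+1%:R^-1).
have u0 k : 0 <= u k by rewrite mulr_ge0 ?(ltW T_gt0)// subr_ge0 invf_le1 ?ler1n.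
have uT k : u k < T by rewrite gtr_pMr// gtrBl invr_gt0.
have ucvg : u @ \oo --> T.
  have : u @ \oo --> T * (1 - 0).
    by apply: cvgMl_tmp; apply: cvgB; [exact: cvg_cst|exact: cvg_harmonic].
  by rewrite subr0 mulr1.
have GN : <<s G >> (~` N) by have [_ GC _] := sG; rewrite -setTD; apply: GC; exact: nullG.
(* Setting the path to zero on the null set [N] makes [h (u k)] converge to [h T] at every outcome,
   so that measurability passes to the limit. *)
pose h t w := W i t w * \1_(~` N) w.
have mW_T : measurable_wrt <<s G >> (h T).
  apply/measurable_wrtP => //.
  apply: (@measurable_fun_cvg _ (g_sigma_algebraType <<s G >>) R setT
    (fun k => h (u k)) (h T)) => [k|w _].
    apply: measurable_funM; last first.
      by apply: measurable_indic; rewrite measurable_g_sigmaE.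
    apply/measurable_wrtP => // E WE.
    by apply: (subG (u k)) => //; exact: (augmented_path (u0 k) (lexx _)) WE.
  rewrite /h indicE; case: (boolP (w \in ~` N)) => [|_] /=; last first.
    by under eq_fun do rewrite mulr0; rewrite mulr0; exact: cvg_cst.
  rewrite inE => Nw; under eq_fun do rewrite mulr1; rewrite mulr1.
  have Ww : {within `[0, T], continuous (W i ^~ w)}.
    by apply: contrapT => Ww; apply/Nw/WN => /(_ i).
  have [_ _ /cvg_at_leftP] := (continuous_within_itvP _ T_gt0).1 Ww.
  by apply; split.
(* Off [N] the event is read on [h T]; its part inside [N] is a measurable null set, which [F 0]
   contains. *)
rewrite (_ : _ @^-1` _ =
  (h T @^-1` B `&` ~` N) `|` (W i T @^-1` B `&` N)); last first.
  apply/seteqP; split=> w /=.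
    by have [Nw|Nw] := pselect (N w); [right|left; rewrite /h indicE mem_set ?mulr1].
  by case=> [[+ Nw]|[]//]; rewrite /h indicE mem_set ?mulr1.
apply: (sigma_algebra_setU sG).
  by apply: (sigma_algebra_setI sG) => //; apply: mW_T; exists B; rewrite ?setTI.
have mWB : measurable (W i T @^-1` B `&` N).
  apply: measurableI => //; rewrite -[X in measurable X]setTI.
  by apply: mW => //; rewrite lexx ltW.
apply: nullG => //; apply/eqP; rewrite -measure_le0 -PN.
by apply: le_measure; rewrite ?inE.
Qed.

End augmented_filtration.

(** * Costs and minimizers *)

(** Here [l], [m] are the initial and [a], [b] the running parts of two minimizers, [c] is the
    running part at the midpoint and [e] the convexity gap. Since the minimum is finite, all terms
    are real; the midpoint then costs the minimum minus [e / 2], and it cannot cost less than the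
    minimum. *)
Lemma midpoint_gap_eq0 (R : realFieldType) (l m : R) (a b c e : \bar R) :
  (0 <= a -> 0 <= b -> 0 <= c -> 0 <= e ->
  (2^-1 * m)%:E + (2^-1)%:E * b < +oo ->
  (2^-1 * l)%:E + (2^-1)%:E * a <= (2^-1 * m)%:E + (2^-1)%:E * b ->
  (2^-1 * m)%:E + (2^-1)%:E * b <=
    (2^-1 * (2^-1 * (l + m)))%:E + (2^-1)%:E * c ->
  (2^-1 * m)%:E + (2^-1)%:E * b <= (2^-1 * l)%:E + (2^-1)%:E * a ->
  e + c = (2^-1)%:E * (a + b) -> e = 0)%E.
Proof.
have half : 0 < 2^-1 :> R by rewrite invr_gt0.
move: b => [b| |]//; last by rewrite mulry gtr0_sg// mul1e.
move: a => [a| |]//; last by rewrite mulry gtr0_sg// mul1e.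
move: c e => [c| |]// [e| |]//=.
rewrite -!EFinM -!EFinD !lee_fin => a0 b0 c0 e0 _ h1 h2 h3 [h4].
by congr EFin; lra.
Qed.

Section costs.
Context (R : realType) d (Omega : measurableType d) (P : probability Omega R).
Context (T : R) (F : R -> set (set Omega)).
Hypothesis T_gt0 : 0 < T.
Hypothesis F_sigma : forall t, sigma_algebra setT (F t).
Hypothesis F_measurable : forall t, t <= T -> F t `<=` measurable.
Hypothesis F_mono : forall s t, s <= t -> F s `<=` F t.
Context (n : nat) (V : 'M[R]_n).
Hypothesis VVt : V *m V^T = 1%:M.
Context (Sigma0 : 'I_n -> R) (s : 'I_n -> R -> Omega -> R).
Context (C : 'M[R]_n) (sigma : R -> Omega -> 'M[R]_n).
Hypothesis C_diag : C = diag_in_basis V Sigma0.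
Hypothesis sigma_diag : forall t w, 0 <= t <= T ->
  sigma t w = diag_in_basis V (fun i => s i t w).
Hypothesis s_measurable : forall i, jointly_measurable T (s i).
Hypothesis s_gt0 : forall i t w, 0 <= t <= T -> 0 < s i t w.

Let expectationE (X : Omega -> R) : ('E_P[X] = \int[P]_w (X w)%:E)%E.
Proof. by rewrite unlock. Qed.

Let admissible := @posdef_closed_martingales R d Omega P F T n.

Definition basis_coord (M : R -> Omega -> 'M[R]_n) i t w :=
  (V^T *m M t w *m V) i i.

Definition diag_process (x : 'I_n -> R -> Omega -> R) t w :=
  diag_in_basis V (fun i => x i t w).

Lemma admissible_entry M i j : admissible M ->
  closed_martingale P T F (fun t w => M t w i j).
Proof. by move=> [aM iM _ cM]; split=> [||t tT]; [exact: aM|exact: iM|exact: cM]. Qed.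

Lemma positive_martingaleP x : positive_martingales P F T x <->
  closed_martingale P T F x /\ forall t w, 0 <= t <= T -> 0 < x t w.
Proof.
by split=> -[mx x0]; split=> //; exact/(closed_martingaleP _ T_gt0 F_mono).
Qed.

Lemma basis_coord_martingale M i : admissible M ->
  positive_martingales P F T (basis_coord M i).
Proof.
move=> aM; apply/positive_martingaleP; split; last first.
  by move=> t w tT; apply: basis_coord_gt0 => //; have [_ _ + _] := aM; apply.
have := @closed_martingale_sum R d Omega P T F F_sigma F_measurable 'I_n
  (index_enum 'I_n) (fun=> 1) (fun j t w => \sum_k (V k i * V j i) * M t w k j).
move=> /(_ (fun j => @closed_martingale_sum R d Omega P T F F_sigma F_measurable
  'I_n (index_enum 'I_n) (fun k => V k i * V j i) (fun k t w => M t w k j)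
  (fun k => admissible_entry k j aM))).
congr closed_martingale; apply/funext => t; apply/funext => w.
by rewrite /basis_coord basis_coord_entry; apply: eq_bigr => j _; rewrite mul1r.
Qed.

Lemma diag_process_admissible x :
  (forall i, positive_martingales P F T (x i)) -> admissible (diag_process x).
Proof.
move=> mx; have cx i := ((positive_martingaleP (x i)).1 (mx i)).1.
have cE i j : closed_martingale P T F (fun t w => diag_process x t w i j).
  have := @closed_martingale_sum R d Omega P T F F_sigma F_measurable 'I_n
    (index_enum 'I_n) (fun k => V i k * V j k) x cx.
  congr closed_martingale; apply/funext => t; apply/funext => w.
  by rewrite /diag_process diag_in_basis_entry.
split=> [i j|i j|t w tT|t tT i j].
- by have [] := cE i j.
- by have [] := cE i j.
- by apply/posdefmx_diag_in_basis => // i; have [_] := mx i; apply.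
- by have [_ _] := cE i j; apply.
Qed.

Lemma midpoint_martingale x y : positive_martingales P F T x ->
  positive_martingales P F T y ->
  positive_martingales P F T (fun t w => 2^-1 * (x t w + y t w)).
Proof.
move=> /positive_martingaleP[cx x0] /positive_martingaleP[cy y0].
apply/positive_martingaleP; split; last first.
  by move=> t w tT; rewrite mulr_gt0 ?invr_gt0// addr_gt0 ?x0 ?y0.
have := @closed_martingale_sum R d Omega P T F F_sigma F_measurable
  bool [:: true; false] (fun=> 2^-1) (fun b => if b then x else y)
  (fun b => if b return closed_martingale P T F (if b then x else y) then cx else cy).
congr closed_martingale; apply/funext => t; apply/funext => w.
by rewrite !big_cons big_nil addr0 mulrDr.
Qed.

Lemma positive_martingale1 : positive_martingales P F T (fun _ _ => 1).
Proof.
by apply/positive_martingaleP; split=> //; exact: closed_martingale_cst.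
Qed.

(** For admissible [M] the integral is finite, so [fine] loses nothing. *)
Definition initial_cost (M : R -> Omega -> 'M[R]_n) : R :=
  fine (\int[P]_w (\sum_i Sigma0 i * basis_coord M i 0 w)%:E)%E.

Definition running_cost (M : R -> Omega -> 'M[R]_n) t w :=
  \sum_i s i t w ^+ 2 * (V^T *m invmx (M t w) *m V) i i.

Let T0 : 0 <= (0 : R) <= T. Proof. by rewrite lexx ltW. Qed.

Let integrable_basis_coord M i : admissible M ->
  P.-integrable setT (EFin \o basis_coord M i 0).
Proof.
by move=> /(basis_coord_martingale i)[[_ iM _] _]; exact: iM.
Qed.

(** Separates a real initial part from a running part that may be infinite. *)
Lemma matrix_costE M : admissible M -> matrix_cost P T C sigma M =
  ((2^-1 * initial_cost M)%:E +
   (2^-1)%:E * space_time_integral P T (running_cost M))%E.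
Proof.
move=> aM; rewrite /matrix_cost expectationE; congr (_ + _ * _)%E.
  rewrite EFinM; congr (_ * _)%E.
  rewrite (eq_integral (fun w => (\sum_i Sigma0 i * basis_coord M i 0 w)%:E)).
    rewrite fineK//; apply: integrable_fin_num => //.
    by apply: integrable_lincomb => i; exact: integrable_basis_coord.
  by move=> w _ /=; rewrite C_diag mxtrace_diag_in_basis.
apply: eq_space_time_integral => t w tT.
by rewrite sigma_diag// mul_diag_in_basis// mxtrace_diag_in_basis.
Qed.

Lemma running_cost_measurable M : admissible M ->
  jointly_measurable T (running_cost M).
Proof.
move=> aM; apply: jointly_measurable_sum => i; apply: jointly_measurableM.
  exact: jointly_measurableM.
have mMV j k : jointly_measurable T (fun t w => invmx (M t w) k j).
  apply: (@measurable_invmx _ _ _ _ n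
    (fun p : (Omega * measurableTypeR R)%type => M p.2 p.1)).
    move=> [w t] [_ /=]; rewrite in_itv/= => tT.
    by apply: posdefmx_unit; have [_ _ + _] := aM; apply.
  by move=> k' j'; have [+ _ _ _] := aM => /(_ k' j') [].
rewrite (_ : (fun t w => _) = (fun t w =>
    \sum_j \sum_k (V k i * V j i) * invmx (M t w) k j)); last first.
  by apply/funext => t; apply/funext => w; rewrite basis_coord_entry.
by do 2 apply: jointly_measurable_sum => ?; exact: jointly_measurableZ.
Qed.

(** The diagonal of the inverse is bounded below by 1 / (V^T M V)_ii, which is positive. *)
Lemma running_cost_ge0 M : admissible M -> nonneg_process T (running_cost M).
Proof.
move=> aM t w tT; apply: sumr_ge0 => i _; rewrite mulr_ge0 ?sqr_ge0//.
have Mpos : posdefmx (M t w) by have [_ _ + _] := aM; apply.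
by rewrite (le_trans _ (inv_basis_coord_le _ i Mpos))// invr_ge0 ltW ?basis_coord_gt0.
Qed.

Lemma basis_coord_diag_process x i t w : basis_coord (diag_process x) i t w = x i t w.
Proof.
by rewrite /basis_coord diag_in_basis_coord// !mxE eqxx mulr1n.
Qed.

Lemma running_cost_diag_process x t w : (forall i, 0 < x i t w) ->
  running_cost (diag_process x) t w = \sum_i s i t w ^+ 2 * (x i t w)^-1.
Proof.
move=> x0; apply: eq_bigr => i _.
rewrite /diag_process invmx_diag_in_basis//; last by move=> j; rewrite gt_eqF.
by rewrite diag_in_basis_coord// !mxE eqxx mulr1n.
Qed.

Let scalar_running_measurable x i : positive_martingales P F T x ->
  jointly_measurable T (fun t w => s i t w ^+ 2 * (x t w)^-1).
Proof.
move=> [[[mx _] _ _] _]; apply: jointly_measurableM.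
  exact: jointly_measurableM.
exact: measurable_fun_inv.
Qed.

Let scalar_running_ge0 x i : positive_martingales P F T x ->
  nonneg_process T (fun t w => s i t w ^+ 2 * (x t w)^-1).
Proof.
by move=> [_ x0] t w tT; rewrite mulr_ge0 ?sqr_ge0// invr_ge0 ltW ?x0.
Qed.

Lemma matrix_cost_diag_process x :
  (forall i, positive_martingales P F T (x i)) ->
  matrix_cost P T C sigma (diag_process x) =
  (\sum_i scalar_cost P T (Sigma0 i) (s i) (x i))%E.
Proof.
move=> mx; have ax := diag_process_admissible mx.
have ix i : P.-integrable setT (EFin \o x i 0).
  by have [[_ + _] _] := mx i; apply.
rewrite matrix_costE// /scalar_cost.
have -> : space_time_integral P T (running_cost (diag_process x)) =
    (\sum_i space_time_integral P T (fun t w => s i t w ^+ 2 * (x i t w)^-1)%R)%E.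
  rewrite -space_time_integral_sum; last 2 first.
  - by move=> i; exact: scalar_running_measurable.
  - by move=> i; exact: scalar_running_ge0.
  apply: eq_space_time_integral => t w tT; apply: running_cost_diag_process => i.
  by have [_] := mx i; apply.
(* The running terms may be infinite; nonnegativity justifies distributing the factor one half over
   their sum. *)
rewrite ge0_sume_distrr; last first.
  by move=> i _; apply: space_time_integral_ge0; exact: scalar_running_ge0.
pose a i : R := Sigma0 i * fine (\int[P]_w (x i 0 w)%:E)%E.
have aE i : (\int[P]_w (Sigma0 i * x i 0 w)%:E = (a i)%:E)%E.
  under eq_integral do rewrite EFinM.
  rewrite integralZl//; last exact: ix.
  by rewrite /a EFinM fineK//; apply: integrable_fin_num => //; exact: ix.
have -> : initial_cost (diag_process x) = \sum_i a i.
  rewrite /initial_cost; apply: EFin_inj; rewrite fineK; last first.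
    apply: integrable_fin_num => //; apply: integrable_lincomb => i.
    exact: integrable_basis_coord.
  under eq_integral do under eq_bigr do rewrite basis_coord_diag_process.
  rewrite integral_lincomb// -sumEFin; apply: eq_bigr => i _.
  by rewrite /a EFinM fineK//; apply: integrable_fin_num => //; exact: ix.
rewrite mulr_sumr -sumEFin -big_split; apply: eq_bigr => i _ /=.
by rewrite expectationE aE EFinM.
Qed.

(** Pinching keeps only the diagonal in the basis [V]: the initial cost sees nothing else, and the
    running cost drops pointwise by [inv_basis_coord_le]. *)
Lemma matrix_cost_pinching M : admissible M ->
  (matrix_cost P T C sigma (diag_process (basis_coord M))
   <= matrix_cost P T C sigma M)%E.
Proof.
move=> aM; have mN i := basis_coord_martingale i aM.
have aN := diag_process_admissible mN.
have initE : initial_cost (diag_process (basis_coord M)) = initial_cost M.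
  congr fine; apply: eq_integral => w _; congr EFin; apply: eq_bigr => i _.
  by rewrite basis_coord_diag_process.
rewrite (matrix_costE aN) (matrix_costE aM) initE.
apply: leeD2l; apply: lee_wpmul2l; first by rewrite lee_fin invr_ge0.
apply: le_space_time_integral.
- exact: running_cost_measurable.
- exact: running_cost_ge0.
- exact: running_cost_measurable.
move=> t w tT; have Mpos : posdefmx (M t w) by have [_ _ + _] := aM; apply.
rewrite running_cost_diag_process; last by move=> i; exact: basis_coord_gt0.
by apply: ler_sum => i _; rewrite ler_wpM2l ?sqr_ge0// inv_basis_coord_le.
Qed.

(** Pinching reduces any competitor to a diagonal one, whose cost is a sum of scalar costs that can
    be minimized separately. *)
Lemma diag_process_minimizer x :
  (forall i, is_minimizer (positive_martingales P F T)
     (scalar_cost P T (Sigma0 i) (s i)) (x i)) ->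
  is_minimizer admissible (matrix_cost P T C sigma) (diag_process x).
Proof.
move=> xmin; have mx i : positive_martingales P F T (x i) by have [] := xmin i.
split=> [|M aM]; first exact: diag_process_admissible.
apply: le_trans (matrix_cost_pinching aM).
have mN i := basis_coord_martingale i aM.
rewrite !matrix_cost_diag_process//.
by apply: lee_sum => i _; have [_] := xmin i; apply.
Qed.

(** * Uniqueness of the minimizer *)

Hypothesis sigma_sqintegrable :
  (\int[lebesgue_measure]_(t in `[0%R, T])
     'E_P[fun w => (\tr (sigma t w *m (sigma t w)^T))%R] < +oo)%E.

(** At the identity the running cost is tr(sigma^2), which is tr(sigma sigma^T) by symmetry; any
    minimizer thus has a cost below [+oo]. *)
Lemma matrix_cost_identity_lty :
  (matrix_cost P T C sigma (diag_process (fun _ _ _ => 1%R)) < +oo)%E.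
Proof.
have a1 := diag_process_admissible (fun=> positive_martingale1).
rewrite matrix_costE// lte_add_pinfty ?ltry//.
rewrite lte_mul_pinfty ?lee_fin ?invr_ge0//.
rewrite space_time_integral_swap; last 2 first.
- exact: running_cost_measurable.
- exact: running_cost_ge0.
move: sigma_sqintegrable; congr (_ < _)%E; apply: eq_integral => t.
rewrite inE/= in_itv/= => tT; rewrite expectationE; apply: eq_integral => w _.
congr EFin; rewrite running_cost_diag_process// sigma_diag//.
rewrite trmx_diag_in_basis mul_diag_in_basis// -[X in \tr X]mulmx1.
rewrite mxtrace_diag_in_basis mulmx1 mulmx1C//.
by apply: eq_bigr => i _; rewrite mxE eqxx invr1 expr2.
Qed.

(* Compare both minimizers with the diagonal process whose diagonal is the
   average of theirs. *)
Lemma minimizer_diag_process_ae x M :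
  (forall i, is_minimizer (positive_martingales P F T)
     (scalar_cost P T (Sigma0 i) (s i)) (x i)) ->
  is_minimizer admissible (matrix_cost P T C sigma) M ->
  \forall t \ae lebesgue_measure, 0 <= t <= T ->
    \forall w \ae P, M t w = diag_process x t w.
Proof.
move=> xmin [aM Mmin]; have mx i : positive_martingales P F T (x i) by have [] := xmin i.
have [ax Xmin] := diag_process_minimizer xmin.
pose c i t w := 2^-1 * (basis_coord M i t w + x i t w).
have mc i : positive_martingales P F T (c i).
  by apply: midpoint_martingale => //; exact: basis_coord_martingale.
have ac := diag_process_admissible mc.
have Mpos t w : 0 <= t <= T -> posdefmx (M t w) by have [_ _ + _] := aM; apply.
pose qM := running_cost M; pose qx := running_cost (diag_process x).
pose qc := running_cost (diag_process c).
have mid t w : 0 <= t <= T ->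
    qc t w <= 2^-1 * (qM t w + qx t w) ?= iff (M t w == diag_process x t w).
  move=> tT; rewrite /qc /qx !running_cost_diag_process; last 2 first.
  - by move=> i; have [_] := mx i; apply.
  - by move=> i; have [_] := mc i; apply.
  (* The equality case needs strictly positive weights, whence [s_gt0]. *)
  apply: (inv_cost_midpoint VVt (Mpos _ _ tT)) => i.
    by rewrite exprn_gt0// s_gt0.
  by have [_] := mx i; apply.
(* By [mid] this convexity gap is nonnegative and vanishes exactly where the two processes agree. *)
pose g t w := 2^-1 * (qM t w + qx t w) - qc t w.
have [mM mX mC] := And3 (running_cost_measurable aM)
  (running_cost_measurable ax) (running_cost_measurable ac).
have [M0 X0 C0] := And3 (running_cost_ge0 aM)
  (running_cost_ge0 ax) (running_cost_ge0 ac).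
have mh : jointly_measurable T (fun t w => 2^-1 * (qM t w + qx t w)).
  by apply: jointly_measurableZ; exact: jointly_measurableD.
have mg : jointly_measurable T g by exact: (measurable_funB mh mC).
have g0 : nonneg_process T g by move=> t w tT; rewrite subr_ge0 (mid _ _ tT).
pose I X := space_time_integral P T X.
have Ig : (I g + I qc = (2^-1)%:E * (I qM + I qx))%E.
  rewrite -space_time_integralD//.
  rewrite -(space_time_integralD P mM M0 mX X0) -space_time_integralZ//.
  - by apply: eq_space_time_integral => t w _; rewrite subrK.
  - exact: jointly_measurableD.
  - by move=> t w tT; rewrite addr_ge0 ?M0 ?X0.
have a1 := diag_process_admissible (fun=> positive_martingale1).
have Xfin := le_lt_trans (Xmin _ a1) matrix_cost_identity_lty.
have XM := Xmin _ aM; have MX := Mmin _ ax; have XC := Xmin _ ac.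
(* The initial cost is linear in the diagonal, so all strict convexity comes from the running
   cost. *)
have initC : initial_cost (diag_process c) =
    2^-1 * (initial_cost M + initial_cost (diag_process x)).
  pose Y b w := \sum_i Sigma0 i *
    basis_coord (if b then M else diag_process x) i 0 w.
  have iY b : P.-integrable setT (EFin \o Y b).
    apply: integrable_lincomb => i; apply: integrable_basis_coord.
    by case: b.
  rewrite {1}/initial_cost.
  rewrite (eq_integral (fun w => (\sum_(b <- [:: true; false]) 2^-1 * Y b w)%:E)).
    rewrite integral_lincomb//= !big_cons big_nil adde0.
    rewrite -[initial_cost M]/(fine (\int[P]_w (Y true w)%:E)%E).
    rewrite -[initial_cost (diag_process x)]/(fine (\int[P]_w (Y false w)%:E)%E).
    have := integrable_fin_num measurableT (iY true).
    have := integrable_fin_num measurableT (iY false).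
    move: (\int[P]_w _)%E (\int[P]_w _)%E => [a| |]// [b| |]// _ _ /=.
    by rewrite mulrDr.
  move=> w _; congr EFin; rewrite !big_cons big_nil addr0 -mulrDr -big_split.
  rewrite mulr_sumr; apply: eq_bigr => i _ /=.
  by rewrite !basis_coord_diag_process /c -mulrDr mulrCA.
have gE0 : I g = 0%E.
  move: Xfin MX XC XM Ig.
  rewrite (matrix_costE aM) (matrix_costE ax) (matrix_costE ac) initC.
  apply: midpoint_gap_eq0; exact: space_time_integral_ge0.
have := space_time_integral_eq0 mg g0 gE0.
apply: (@filterS _ _ (ae_filter_ringOfSetsType _)) => t gt0 tT.
move: (gt0 tT); apply: filterS => w.
by move=> /eqP; rewrite subr_eq0 eq_sym (mid _ _ tT) => /eqP.
Qed.

(** Entrywise differences are closed martingales, and every interval []t0, T[] contains one of the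
    times at which they vanish almost surely. *)
Lemma minimizer_diag_process_unique x M :
  F T `<=` <<s \bigcup_(t in `[0, T[) F t >> ->
  (forall i, is_minimizer (positive_martingales P F T)
     (scalar_cost P T (Sigma0 i) (s i)) (x i)) ->
  is_minimizer admissible (matrix_cost P T C sigma) M ->
  forall t, 0 <= t <= T -> \forall w \ae P, M t w = diag_process x t w.
Proof.
move=> F_left xmin Mmin.
have [[aM _] [ax _]] := (Mmin, diag_process_minimizer xmin).
have aeMx := minimizer_diag_process_ae xmin Mmin.
pose Z (p : 'I_n * 'I_n) t w := M t w p.1 p.2 - diag_process x t w p.1 p.2.
have cZ p : closed_martingale P T F (Z p).
  by apply: closed_martingaleB => //; exact: admissible_entry.
move=> t tT.
(* There are finitely many entries, so a single null set serves them all. *)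
have : \forall w \ae P, forall p, Z p t w = 0.
  apply: filter_forall => p; apply: closed_martingale_eq0 (cZ p) _ _ tT => //.
  move=> t0 /andP[t00 t0T].
  have [u /andP[t0u uT] Mxu] := ae_lebesgue_itv_ex t0T aeMx.
  exists u; first by rewrite t0u.
  have /Mxu : 0 <= u <= T by rewrite (le_trans t00 (ltW t0u)) ltW.
  by apply: filterS => w Mx; rewrite /Z Mx subrr.
apply: filterS => w Z0; apply/matrixP => i j.
by apply/eqP; rewrite -subr_eq0; apply/eqP; exact: (Z0 (i, j)).
Qed.

End costs.

Theorem proposition5p2 (R : realType) (d : measure_display)
    (Omega : measurableType d) (P : probability Omega R)
    (T : R) (T_gt0 : 0 < T) (n : nat)
    (W : 'I_n -> R -> Omega -> R) (W_brownian : brownian_motion P T W)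
    (sigma : R -> Omega -> 'M[R]_n)
    (sigma_posdef : forall t w, 0 <= t <= T -> posdefmx (sigma t w))
    (sigma_adapted : forall i j,
      adapted_process (augmented_filtration P W) T (fun t w => sigma t w i j))
    (sigma_sqintegrable :
      (\int[lebesgue_measure]_(t in `[0%R, T])
         'E_P[fun w => (\tr (sigma t w *m (sigma t w)^T))%R] < +oo)%E)
    (m nu : 'I_n -> R -> Omega -> R)
    (m_adapted : forall i,
      adapted_process (augmented_filtration P W) T (m i))
    (nu_adapted : forall i,
      adapted_process (augmented_filtration P W) T (nu i))
    (C : 'M[R]_n) (C_posdef : posdefmx C)
    (V : 'M[R]_n) (V_orthogonal : V *m V^T = 1%:M)
    (Sigma0 : 'I_n -> R) (C_diag : C = diag_in_basis V Sigma0)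
    (s : 'I_n -> R -> Omega -> R)
    (sigma_diag : forall t w, 0 <= t <= T ->
      sigma t w = diag_in_basis V (fun i => s i t w))
    (s_sde : forall i,
      solves_sde P (augmented_filtration P W) T (m i) (nu i) (W i) (s i))
    (Mbar : 'I_n -> R -> Omega -> R)
    (Mbar_min : forall i,
      is_minimizer (positive_martingales P (augmented_filtration P W) T)
        (scalar_cost P T (Sigma0 i) (s i)) (Mbar i)) :
  let admissible :=
    @posdef_closed_martingales R d Omega P (augmented_filtration P W) T n in
  let Mstar := fun t w => diag_in_basis V (fun i => Mbar i t w) in
  is_minimizer admissible (matrix_cost P T C sigma) Mstar
  /\ forall M, is_minimizer admissible (matrix_cost P T C sigma) M ->
       forall t, 0 <= t <= T -> \forall w \ae P, M t w = Mstar t w.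
Proof.
move=> admissible Mstar.
have s_measurable i : jointly_measurable T (s i) by have [[]] := s_sde i.
(* The [s i t w] are the eigenvalues of the positive definite matrix [sigma t w]. *)
have s_gt0 i t w : 0 <= t <= T -> 0 < s i t w.
  move=> tT; have := sigma_posdef t w tT; rewrite sigma_diag//.
  by move=> /(posdefmx_diag_in_basis V_orthogonal); apply.
have F_sigma := @augmented_sigma_algebra R d Omega P n W.
have F_measurable := augmented_measurable W_brownian.
have F_mono := @augmented_mono R d Omega P n W.
split=> [|M Mmin]; first exact: (diag_process_minimizer T_gt0 F_sigma F_measurable
  F_mono V_orthogonal C_diag sigma_diag s_measurable).
apply: (minimizer_diag_process_unique T_gt0 F_sigma F_measurable F_mono
  V_orthogonal C_diag sigma_diag s_measurable s_gt0) Mmin => //.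
exact: augmented_left_continuous.
Qed.
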